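(* Let $R$ be a Noetherian local ring with infinite residue field $k$. Let $J\subset I$ be $R$-ideals, and let $I=(f_1,\ldots,f_m)$. Let $n$ be a positive integer and $K_n=\sum_{b\in I}(J,b)^n$. Fix a positive integer $t$. For $\underline{\underline{\lambda}}=[\lambda_{ij}]\in R^{(t+1)m}$ ($1\le i\le t+1$, $1\le j\le m$) put $b_i=\sum_{j=1}^m\lambda_{ij}f_j$ for $1\le i\le t+1$, and set $C_j=\sum_{i=1}^{j}(J,b_i)^n$ for $1\le j\le t+1$. Assume that $C_t=C_{t+1}$ for general elements $b_1,\ldots,b_{t+1}$ in $I$, i.e. there is a dense open subset $U\subset\mathbb{A}_k^{(t+1)m}$ such that $C_t=C_{t+1}$ whenever the image $\overline{\underline{\underline{\lambda}}}$ of $\underline{\underline{\lambda}}$ in $\mathbb{A}_k^{(t+1)m}$ lies in $U$. Then \[ K_n=\sum_{i=1}^t (J,b_i)^n=C_t \] for general elements $b_1,\ldots,b_{t+1}$ in $I$, i.e. there is a dense open subset $U'\subset\mathbb{A}_k^{(t+1)m}$ such that $K_n=C_t$ whenever $\overline{\underline{\underline{\lambda}}}\in U'$.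
   Context: All rings are commutative with identity. For an element $b$ of $R$, $(J,b)=J+bR$, and $\sum_{b\in I}(J,b)^n$ is the sum over all elements $b\in I$. For an integer $N$, $\mathbb{A}_k^{N}$ is the affine space $k^N$ with the Zariski topology. *)

(* Defs.v *)
From HB Require Import structures.
From mathcomp Require Import all_boot all_algebra.
From mathcomp Require Import mpoly.
From mathcomp Require Import mathcomp_extra boolp classical_sets functions cardinality.
From mathcomp Require Import topology.

Set Implicit Arguments.
Unset Strict Implicit.
Unset Printing Implicit Defensive.

Import GRing.Theory.
Local Open Scope classical_set_scope.
Local Open Scope ring_scope.

(* MathComp's [idealr_closed] only covers proper ideals, whereas the unit ideal
   is allowed here; hence ideals are treated as classical sets. *)
Definition is_ideal (R : comNzRingType) (A : set R) : Prop :=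
  A 0 /\ forall a x y : R, A x -> A y -> A (a * x + y).

Definition ideal_gen (R : comNzRingType) (S : set R) : set R :=
  smallest (@is_ideal R) S.

Definition ideal_sum (R : comNzRingType) (T : Type) (D : set T)
    (A : T -> set R) : set R :=
  ideal_gen (\bigcup_(i in D) A i).

Definition ideal_mul (R : comNzRingType) (A B : set R) : set R :=
  ideal_gen [set x * y | x in A & y in B].

Definition ideal_exp (R : comNzRingType) (A : set R) (n : nat) : set R :=
  iter n (ideal_mul A) setT.

(* (J, b) = J + bR *)
Definition ideal_adjoin (R : comNzRingType) (J : set R) (b : R) : set R :=
  [set x + b * r | x in J & r in [set: R]].

Definition noetherian (R : comNzRingType) : Prop :=
  forall A : set R, is_ideal A ->
    exists s : seq R, A = ideal_gen [set x | x \in s].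

Definition maximal_ideal (R : comNzRingType) (M : set R) : Prop :=
  [/\ is_ideal M, M <> setT
    & forall A : set R, is_ideal A -> M `<=` A -> A = M \/ A = setT].

Definition local_ring (R : comNzRingType) (M : set R) : Prop :=
  maximal_ideal M /\ forall A : set R, maximal_ideal A -> A = M.

(* [pi] exhibits [k] as the residue field R / M. *)
Definition residue_map (R : comNzRingType) (M : set R) (k : fieldType)
    (pi : {rmorphism R -> k}) : Prop :=
  (forall y : k, exists x : R, pi x = y) /\ [set x | pi x = 0] = M.

(* An alias of ['rV[k]_N], carrying the Zariski topology. *)
Definition affine_space (k : fieldType) (N : nat) : Type := 'rV[k]_N.

HB.instance Definition _ (k : fieldType) (N : nat) :=
  Choice.copy (affine_space k N) 'rV[k]_N.

Definition zero_locus (k : fieldType) (N : nat) (S : set {mpoly k[N]}) :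
    set (affine_space k N) :=
  [set x : 'rV[k]_N | forall p, S p -> p.@[x ord0] = 0].

Definition zariski_open (k : fieldType) (N : nat)
    (U : set (affine_space k N)) : Prop :=
  exists S : set {mpoly k[N]}, U = ~` zero_locus S.

Lemma zariski_openT (k : fieldType) (N : nat) :
  zariski_open [set: affine_space k N].
Proof.
exists [set 1]; apply/seteqP; split=> // x _ /= /(_ 1 erefl) /eqP.
by rewrite meval1 oner_eq0.
Qed.

Lemma zariski_openI (k : fieldType) (N : nat) :
  setI_closed (@zariski_open k N).
Proof.
move=> _ _ [S ->] [T ->]; exists [set p * q | p in S & q in T].
rewrite -setCU; congr (~` _); apply/seteqP; split=> x /=.
  move=> [Sx|Tx] _ [p Sp [q Tq <-]]; rewrite mevalM.
    by rewrite Sx // mul0r.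
  by rewrite (Tx q) // mulr0.
move=> STx; apply: contrapT => /not_orP [] /existsNP [p /not_implyP [Sp px]].
move=> /existsNP [q /not_implyP [Tq qx]].
have /eqP : (p * q).@[(x : 'rV[k]_N) ord0] = 0.
  by apply: STx; exists p => //; exists q.
by rewrite mevalM mulf_eq0 => /orP [] /eqP.
Qed.

Lemma zariski_open_bigU (k : fieldType) (N : nat) (I : Type)
    (U : I -> set (affine_space k N)) :
  (forall i, zariski_open (U i)) -> zariski_open (\bigcup_i U i).
Proof.
move=> /choice [S US]; exists (\bigcup_i S i).
rewrite -[LHS]setCK setC_bigcup; congr (~` _); apply/seteqP; split=> x /=.
  by move=> Ux p [i _ Sp]; move: (Ux i Logic.I); rewrite US setCK; apply.
by move=> Sx i _; rewrite US setCK => p Sp; apply: Sx; exists i.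
Qed.

HB.instance Definition _ (k : fieldType) (N : nat) :=
  isOpenTopological.Build (affine_space k N)
    (@zariski_openT k N) (@zariski_openI k N) (@zariski_open_bigU k N).

(* The image in affine space of a matrix over R; the entry (i, j) becomes the
   coordinate [mxvec_index i j]. *)
Definition reduction (R : comNzRingType) (k : fieldType)
    (pi : {rmorphism R -> k}) (s m : nat) (lam : 'M[R]_(s, m)) :
    affine_space k (s * m) :=
  mxvec (map_mx pi lam).

Definition for_general (R : comNzRingType) (k : fieldType)
    (pi : {rmorphism R -> k}) (s m : nat) (P : 'M[R]_(s, m) -> Prop) : Prop :=
  exists U : set (affine_space k (s * m)),
    [/\ open U, dense U & forall lam, U (reduction pi lam) -> P lam].

Definition comb (R : comNzRingType) (s m : nat) (f : 'I_m -> R)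
    (lam : 'M[R]_(s, m)) (i : 'I_s) : R :=
  \sum_(j < m) lam i j * f j.

Definition K_ideal (R : comNzRingType) (J I : set R) (n : nat) : set R :=
  ideal_sum I (fun b => ideal_exp (ideal_adjoin J b) n).

(* Rows are indexed from 0, so the first j rows are those with index < j. *)
Definition C_ideal (R : comNzRingType) (J : set R) (n s m : nat)
    (f : 'I_m -> R) (lam : 'M[R]_(s, m)) (j : nat) : set R :=
  ideal_sum [set i : 'I_s | (i < j)%N]
    (fun i => ideal_exp (ideal_adjoin J (comb f lam i)) n).

(* Main.v *)
(* The open set can be kept: U' = U. Take lambda in U and let b in I be
   arbitrary. Join lambda, by a line, to the matrix obtained by replacing its
   last row by coefficients of b, and let the last generator at the parameter s
   be b + s d. A polynomial not vanishing at lambda has finitely many roots on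
   this line, so for all but finitely many residues of s the hypothesis puts
   (J, b + s d)^n in C_(t+1) = C_t, where C_t is constant along the line. Hence,
   for a in J^(n-i), the polynomial a (b + s d)^i takes values in the ideal C_t
   at more points than its degree, with unit differences; interpolation to
   s = 0 gives a b^i in C_t. *)

Require Import Defs.
From HB Require Import structures.
From mathcomp Require Import all_boot all_algebra.
From mathcomp Require Import ring.
From mathcomp Require Import mpoly.
From mathcomp Require Import mathcomp_extra boolp classical_sets functions cardinality.

Set Implicit Arguments.
Unset Strict Implicit.
Unset Printing Implicit Defensive.

Import GRing.Theory.
Local Open Scope classical_set_scope.
Local Open Scope ring_scope.

(** * Ideals as sets: sums, powers, units of a local ring, interpolation *)

Section Ideals.
Variable R : comNzRingType.
Implicit Types (A B J : set R) (a b x y : R).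

Lemma is_idealMl A a x : is_ideal A -> A x -> A (a * x).
Proof. by move=> [A0 AD] Ax; rewrite -[a * x]addr0; apply: AD. Qed.

Lemma is_idealD A x y : is_ideal A -> A x -> A y -> A (x + y).
Proof. by move=> [_ AD] Ax; rewrite -[x in x + y]mul1r; apply: AD. Qed.

Lemma is_idealB A x y : is_ideal A -> A x -> A y -> A (x - y).
Proof.
by move=> iA Ax Ay; rewrite -mulN1r; apply: is_idealD => //; apply: is_idealMl.
Qed.

Lemma is_ideal_sum A m (F : 'I_m -> R) :
  is_ideal A -> (forall i, A (F i)) -> A (\sum_i F i).
Proof.
move=> iA AF; elim/big_ind: _ => //; first by case: iA.
by move=> x y; apply: is_idealD.
Qed.

Lemma ideal_gen_is_ideal (S : set R) : is_ideal (ideal_gen S).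
Proof.
split=> [A [[A0 _] _] //|a x y Sx Sy A AS].
by case: (AS) => -[_ AD] _; apply: AD; [apply: Sx | apply: Sy].
Qed.

Lemma sub_ideal_gen (S : set R) : S `<=` ideal_gen S.
Proof. exact: sub_gen_smallest. Qed.

Lemma sub_ideal_sum (T : Type) (D : set T) (F : T -> set R) i :
  D i -> F i `<=` ideal_sum D F.
Proof. by move=> Di x Fx; apply: sub_ideal_gen; exists i. Qed.

Lemma ideal_sum_sub (T : Type) (D : set T) (F : T -> set R) A :
  is_ideal A -> (forall i, D i -> F i `<=` A) -> ideal_sum D F `<=` A.
Proof. by move=> iA FA; apply: smallest_sub => // x [i Di /(FA i Di)]. Qed.

(** This colon ideal of [A] by [c] lets an induction on powers strip off one factor. *)
Lemma is_ideal_residual A c : is_ideal A -> is_ideal [set y | A (c * y)].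
Proof.
move=> iA; split=> [|a x y /= Ax Ay]; first by rewrite /= mulr0; case: iA.
by rewrite mulrDr mulrCA; apply: is_idealD => //; apply: is_idealMl.
Qed.

Lemma ideal_gen_range m (f : 'I_m -> R) b :
  ideal_gen (range f) b -> exists c : 'I_m -> R, b = \sum_j c j * f j.
Proof.
apply: (@smallest_sub _ _ _ [set b | exists c, b = \sum_j c j * f j]).
  split=> [|a _ _ [c ->] [d ->]].
    by exists (fun=> 0); rewrite big1 // => j _; rewrite mul0r.
  exists (fun j => a * c j + d j); rewrite mulr_sumr -big_split /=.
  by apply: eq_bigr => j _; rewrite mulrDl mulrA.
move=> _ [j _ <-]; exists (fun i => (i == j)%:R).
rewrite (bigD1 j) //= eqxx mul1r big1 ?addr0 // => i /negbTE ->.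
by rewrite mul0r.
Qed.

Lemma ideal_expS_mem A n x y :
  A x -> ideal_exp A n y -> ideal_exp A n.+1 (x * y).
Proof. by move=> Ax Ay; apply: sub_ideal_gen; exists x => //; exists y. Qed.

Lemma ideal_exp_is_ideal A n : is_ideal (ideal_exp A n).
Proof. by case: n => [//|n]; apply: ideal_gen_is_ideal. Qed.

Lemma ideal_exp_subset A B n :
  A `<=` B -> ideal_exp A n `<=` ideal_exp B n.
Proof.
move=> AB; elim: n => // n IHn.
apply: smallest_sub; first exact: ideal_exp_is_ideal.
by move=> _ [x Ax [y Ay <-]]; apply: ideal_expS_mem; [apply: AB | apply: IHn].
Qed.

Lemma ideal_adjoin_exp_mem J b p i a : is_ideal J ->
  ideal_exp J p a -> ideal_exp (ideal_adjoin J b) (i + p) (a * b ^+ i).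
Proof.
move=> [J0 _] Ja; elim: i => [|i IHi].
  rewrite expr0 mulr1; apply: ideal_exp_subset Ja => x Jx.
  by exists x => //; exists 0 => //; rewrite mulr0 addr0.
rewrite exprS mulrCA; apply: ideal_expS_mem => //.
by exists 0 => //; exists 1 => //; rewrite mulr1 add0r.
Qed.

(** The products in the hypothesis generate the power. The induction on [n] passes from [A] to its
    colon ideal by a factor [x + b * r]: multiplying by [x] raises [p], multiplying by [b] raises
    [i]. *)
Lemma ideal_adjoin_exp_sub J b n A : is_ideal A ->
  (forall p i a, (i + p)%N = n -> ideal_exp J p a -> A (a * b ^+ i)) ->
  ideal_exp (ideal_adjoin J b) n `<=` A.
Proof.
elim: n A => [|n IHn] A iA HA.
  move=> x _; rewrite -[x]mulr1 -[1](expr0 b).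
  exact: (HA 0%N).
apply: smallest_sub => // _ [_ [x Jx [r _ <-]] [y Hy <-]].
apply: (IHn _ (is_ideal_residual _ iA)) y Hy => p i a ip Ja /=.
have -> : (x + b * r) * (a * b ^+ i)
  = x * a * b ^+ i + r * (a * b ^+ i.+1) by rewrite exprS; ring.
apply: is_idealD => //.
  by apply: (HA p.+1); [rewrite addnS ip | apply: ideal_expS_mem].
by apply: is_idealMl => //; apply: (HA p) => //; rewrite addSn ip.
Qed.

(** By Zorn, a nonunit [x] lies in an ideal maximal among those avoiding 1; this is a maximal ideal,
    hence equal to [M]. *)
Lemma local_ring_unit (M : set R) x :
  local_ring M -> ~ M x -> exists y, x * y = 1.
Proof.
move=> [_ uniqM] Mx; apply: contrapT => nux; apply: Mx.
(* [set0] is admitted so that the empty chain has an upper bound. *)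
pose P A := A = set0 \/ [/\ is_ideal A, A x & ~ A 1].
have [F FP Ftot|A [PA maxA]] := @Zorn_bigcup R P.
  have [[A FA A0]|Fempty] := pselect (exists2 A, F A & A !=set0); last first.
    left; rewrite -subset0 => y [A FA Ay].
    by apply: Fempty; exists A => //; exists y.
  have FI B : F B -> B !=set0 -> [/\ is_ideal B, B x & ~ B 1].
    by move=> FB [y By]; have [B0|//] := FP B FB; rewrite B0 in By.
  have [iA Ax A1] := FI A FA A0.
  right; split; last 2 [by exists A] => [|[B FB B1]].
  - split=> [|a y z [B FB By] [C FC Cz]]; first by exists A => //; case: iA.
    have [iB _ _] := FI B FB (ex_intro _ y By).
    have [iC _ _] := FI C FC (ex_intro _ z Cz).
    have [BC|CB] := Ftot B C FB FC.
      exists C => //; apply: is_idealD => //.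
        by apply: is_idealMl => //; apply: BC.
    by exists B => //; apply: is_idealD => //; [apply: is_idealMl | apply: CB].
  - by have [_ _] := FI B FB (ex_intro _ 1 B1); apply.
have {PA} [A0|[iA Ax A1]] := PA.
  (* The empty set is not maximal for [P]: the principal ideal of the nonunit [x] is a larger
     member. *)
  exfalso; pose X := [set x * y | y in [set: R]].
  have X0 : X 0 by exists 0; rewrite ?mulr0.
  apply: (maxA X); first by rewrite A0; split=> [//|/(_ 0 X0)].
  right; split.
  - split=> // a _ _ [y _ <-] [z _ <-]; exists (a * y + z) => //; ring.
  - by exists 1; rewrite ?mulr1.
  - by move=> [y _ xy]; apply: nux; exists y.
suff <- : A = M by [].
apply: uniqM; split=> // [AT|B iB AB]; first by apply: A1; rewrite AT.
have [BA|nBA] := pselect (B `<=` A); first by left; apply/seteqP.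
right; apply: contrapT => nBT; apply: (maxA B); first by split.
right; split=> [//||B1]; first exact: AB.
by apply/nBT/seteqP; split=> // y _; rewrite -[y]mulr1; apply: is_idealMl.
Qed.

(* Lagrange interpolation, by induction on the number of nodes: if
   p = p(x) + (X - x) q for a node x, then q again takes values in A at the
   remaining nodes because their differences with x are units. *)
Lemma ideal_interpolation (k : fieldType) (pi : {rmorphism R -> k})
    A (p : {poly R}) (s : seq R) :
  (forall x, pi x != 0 -> exists y, x * y = 1) -> is_ideal A ->
  uniq (map pi s) -> (size p <= size s)%N ->
  (forall x, x \in s -> A p.[x]) -> forall y, A p.[y].
Proof.
move=> units iA; elim: s p => [|x s IHs] p /=.
  by rewrite leqn0 size_poly_eq0 => _ /eqP -> _ y; rewrite horner0; case: iA.
move=> /andP [xs us] sp Ap y.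
have /factor_theorem [q pq] : root (p - p.[x]%:P) x.
  by rewrite rootE !hornerE subrr.
have pE z : p.[z] = (z - x) * q.[z] + p.[x].
  by have /(congr1 (horner^~ z)) := pq; rewrite !hornerE mulrC => <-; ring.
have Ax : A p.[x] by apply: Ap; rewrite mem_head.
rewrite pE; apply: is_idealD => //; apply: is_idealMl => //.
apply: IHs => // [|z zs].
  have [->|q0] := eqVneq q 0; first by rewrite size_poly0.
  have := size_Mmonic q0 (monicXsubC x).
  rewrite size_XsubC addn2 -pq /= -ltnS => <-.
  rewrite (leq_trans (size_polyD _ _)) // size_polyN geq_max sp.
  by rewrite (leq_trans (size_polyC_leq1 _)).
have [|u zxu] := units (z - x).
  rewrite rmorphB subr_eq0; apply: contraNneq xs => <-.
  exact: map_f.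
have -> : q.[z] = u * (p.[z] - p.[x]).
  by rewrite pE addrK mulrA (mulrC u) zxu mul1r.
apply: is_idealMl => //; apply: is_idealB => //.
by apply: Ap; rewrite inE zs orbT.
Qed.

End Ideals.

(** * Polynomials over an infinite field and lines in affine space *)

(** Points are added one at a time: a nonroot of [h] is a nonroot of [q] distinct from the points
    already chosen. *)
Lemma infinite_nonroots (k : fieldType) (q : {poly k}) (N : nat) :
  infinite_set [set: k] -> q != 0 ->
  exists s : seq k, [/\ uniq s, size s = N & forall z, z \in s -> q.[z] != 0].
Proof.
move=> kinf q0; elim: N => [|N [s [us sN sq]]]; first by exists [::].
pose h := q * \prod_(z <- s) ('X - z%:P).
have h0 : h != 0 by rewrite mulf_neq0 // monic_neq0 // monic_prod_XsubC.
have [B _ szB] := infinite_set_fset (size h) kinf.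
have [|hB] := boolP (all (root h) (finmap.enum_fset B)).
  move=> /(max_poly_roots h0) /(_ (finmap.fset_uniq B)).
  by rewrite ltnNge szB.
have /allPn [z _] := hB; rewrite rootM root_prod_XsubC => /norP [qz zs].
exists (z :: s); split=> /= [||w]; [by rewrite zs | by rewrite sN |].
by rewrite inE => /predU1P [-> //|/sq].
Qed.

Lemma meval_line (k : fieldType) (N : nat) (p : {mpoly k[N]})
    (v w : 'rV[k]_N) :
  exists q : {poly k}, forall z, q.[z] = p.@[(v + z *: w) ord0].
Proof.
exists (\sum_(e <- msupp p)
  (p@_e)%:P * \prod_i ((v ord0 i)%:P + 'X * (w ord0 i)%:P) ^+ e i) => z.
rewrite mevalE horner_sum; apply: eq_bigr => e _.
rewrite hornerM hornerC horner_prod; congr (_ * _); apply: eq_bigr => i _.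
by rewrite horner_exp !hornerE !mxE.
Qed.

(** Some polynomial defining [U] is nonzero at [v + w]. Its restriction [q] to the line is nonzero
    at the parameter 1, so it is not the zero polynomial. *)
Lemma zariski_open_line (k : fieldType) (N : nat) (U : set (affine_space k N))
    (v w : 'rV[k]_N) :
  zariski_open U -> U (v + w) ->
  exists2 q : {poly k}, q != 0 & forall z, q.[z] != 0 -> U (v + z *: w).
Proof.
move=> [S ->] /existsNP [p /not_implyP [Sp /eqP pvw]].
have [q qE] := meval_line p v w; exists q => [|z qz].
  by apply: contraNneq pvw => q0; rewrite -[w]scale1r -qE q0 horner0.
by move=> /(_ p Sp) /eqP; rewrite -qE (negbTE qz).
Qed.

(** * Lifting residues, and combinations of the generators along a line of matrices *)

Lemma residue_lift (R : comNzRingType) (M : set R) (k : fieldType)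
    (pi : {rmorphism R -> k}) (s : seq k) :
  residue_map M pi -> exists s' : seq R, map pi s' = s.
Proof.
move=> [surj _]; elim: s => [|z s [s' <-]]; first by exists [::].
by have [x <-] := surj z; exists (x :: s').
Qed.

Lemma combD (R : comNzRingType) (s m : nat) (f : 'I_m -> R)
    (A B : 'M[R]_(s, m)) i :
  comb f (A + B) i = comb f A i + comb f B i.
Proof.
by rewrite /comb -big_split; apply: eq_bigr => j _; rewrite mxE mulrDl.
Qed.

Lemma combZ (R : comNzRingType) (s m : nat) (f : 'I_m -> R) a
    (A : 'M[R]_(s, m)) i : comb f (a *: A) i = a * comb f A i.
Proof.
by rewrite /comb mulr_sumr; apply: eq_bigr => j _; rewrite mxE mulrA.
Qed.

Lemma reductionDZ (R : comNzRingType) (k : fieldType)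
    (pi : {rmorphism R -> k}) (s m : nat) (A B : 'M[R]_(s, m)) x :
  reduction pi (A + x *: B)
    = mxvec (map_mx pi A) + pi x *: mxvec (map_mx pi B).
Proof. by rewrite /reduction map_mxD map_mxZ !linearD linearZ. Qed.

Lemma eq_C_ideal (R : comNzRingType) (J : set R) (n s m : nat)
    (f : 'I_m -> R) (A B : 'M[R]_(s, m)) (j : nat) :
  (forall i : 'I_s, (i < j)%N -> comb f A i = comb f B i) ->
  C_ideal J n f A j = C_ideal J n f B j.
Proof.
move=> AB; congr ideal_gen; apply/seteqP.
by split=> x [i /= ij Hx]; exists i => //; move: Hx; rewrite AB.
Qed.

Theorem theorem2p4 (R : comNzRingType) (M : set R) (k : fieldType)
    (pi : {rmorphism R -> k}) (J I : set R) (m : nat) (f : 'I_m -> R)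
    (n t : nat)
    (R_noetherian : noetherian R)
    (R_local : local_ring M)
    (k_residue : residue_map M pi)
    (k_infinite : infinite_set [set: k])
    (J_ideal : is_ideal J)
    (I_ideal : is_ideal I)
    (J_sub_I : J `<=` I)
    (I_gen : I = ideal_gen (range f))
    (n_gt0 : (0 < n)%N)
    (t_gt0 : (0 < t)%N)
    (C_stable : for_general pi (fun lam : 'M[R]_(t.+1, m) =>
       C_ideal J n f lam t = C_ideal J n f lam t.+1)) :
  for_general pi (fun lam : 'M[R]_(t.+1, m) =>
    K_ideal J I n = C_ideal J n f lam t).
Proof.
have [U [oU dU UC]] := C_stable; exists U; split=> // lam Ulam.
have units x : pi x != 0 -> exists y, x * y = 1.
  move=> /eqP pix; apply: (local_ring_unit R_local) => Mx; apply: pix.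
  by move: Mx; rewrite -(proj2 k_residue).
have iC : is_ideal (C_ideal J n f lam t) by apply: ideal_gen_is_ideal.
(* Every [comb f lam i] lies in [I], so its summand already occurs in the sum over [I]. *)
apply/seteqP; split; last first.
  apply: ideal_sum_sub => [|i _]; first exact: ideal_gen_is_ideal.
  apply: (@sub_ideal_sum _ _ I (fun b => ideal_exp (ideal_adjoin J b) n)).
  apply: is_ideal_sum => // j; apply: is_idealMl => //.
  by rewrite I_gen; apply: sub_ideal_gen; exists j.
apply: ideal_sum_sub => // b; rewrite I_gen => /ideal_gen_range [c bE].
pose lam0 : 'M[R]_(t.+1, m) :=
  \matrix_(i, j) (if i == ord_max then c j else lam i j).
(* The parameter 1 gives [lam], whose reduction is in [U]; the parameter 0 gives [lam0], whose last
   combination is [b]. *)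
pose line x := lam0 + x *: (lam - lam0).
pose d := comb f (lam - lam0) ord_max.
have line_t x : comb f (line x) ord_max = b + d * x.
  rewrite combD combZ (mulrC d) bE; congr (_ + _).
  by apply: eq_bigr => j _; rewrite mxE eqxx.
have C_line x : C_ideal J n f (line x) t = C_ideal J n f lam t.
  apply: eq_C_ideal => i it; apply: eq_bigr => j _; rewrite !mxE.
  by rewrite ifF ?subrr ?mulr0 ?addr0 // -val_eqE /= ltn_eqF.
have [q q0 qU] : exists2 q : {poly k}, q != 0
    & forall x, q.[pi x] != 0 -> U (reduction pi (line x)).
  have := @zariski_open_line _ _ U (mxvec (map_mx pi lam0))
    (mxvec (map_mx pi (lam - lam0))) oU.
  rewrite -[X in U (_ + X)]scale1r -(rmorph1 pi) -reductionDZ scale1r subrKC.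
  by move=> /(_ Ulam) [q q0 qU]; exists q => // x /qU; rewrite reductionDZ.
apply: ideal_adjoin_exp_sub => // p i a ipn Ja.
pose g : {poly R} := a%:P * (b%:P + d *: 'X) ^+ i.
have gE x : g.[x] = a * (b + d * x) ^+ i by rewrite !hornerE.
(* Interpolating [g] takes [size g] nodes; avoiding the roots of [q] keeps the line in [U] there. *)
have [s [us ss sq]] := infinite_nonroots (size g) k_infinite q0.
have [s' s'E] := residue_lift s k_residue.
have -> : a * b ^+ i = g.[0] by rewrite gE mulr0 addr0.
apply: (ideal_interpolation units iC (s := s')); rewrite ?s'E //.
  by rewrite -ss -s'E size_map.
(* At a node the value of [g] lies in the last summand of C_(t+1), which equals C_t there. *)
move=> x xs'; rewrite gE -line_t -(C_line x) UC; last first.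
  by apply/qU/sq; rewrite -s'E map_f.
rewrite -ipn; apply: (sub_ideal_sum (i := ord_max)) => //=.
exact: ideal_adjoin_exp_mem.
Qed.
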